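(* The monad $\Lambda$ of untyped $\lambda$-terms modulo $\beta\eta$-equivalence, equipped with the abstraction $\mathsf{abs}\colon\Lambda'\to\Lambda$, is an initial object in the category of exponential monads.
   Context: A monad on $\mathsf{Set}$ is $(R,\mu,\eta)$ with $R\colon\mathsf{Set}\to\mathsf{Set}$ a functor, natural transformations $\mu\colon R\circ R\to R$, $\eta\colon I\to R$ with $\mu\circ R\mu=\mu\circ\mu R$ and $\mu\circ\eta R=\mu\circ R\eta=1_R$; a morphism of monads $\phi\colon P\to R$ is a natural transformation with $\phi\circ\mu_P=\mu_R\circ(\phi\phi)$ and $\phi\circ\eta_P=\eta_R$. A left $R$-module is a functor $M\colon\mathsf{Set}\to\mathsf{Set}$ with natural $\rho\colon M\circ R\to M$ satisfying $\rho\circ M\mu=\rho\circ\rho R$, $\rho\circ M\eta=1_M$; a natural transformation $\tau\colon M\to N$ of left $R$-modules is linear if $\rho_N\circ\tau R=\tau\circ\rho_M$. $R$ is a left $R$-module via $\mu$. The derivative $M'(X)=M(X+\{*\})$ of a left $R$-module $M$ is a left $R$-module with action $M\gamma$ followed by $\rho_{X+\{*\}}$, where $\gamma_X\colon R(X)+\{*\}\to R(X+\{*\})$ is $R(\mathrm{inl})$ on $R(X)$ and sends $*$ to $\eta_{X+\{*\}}( * )$. For a monad morphism $f\colon R\to P$ and left $P$-module $M$, $f^*M$ denotes $M$ with the $R$-action $\rho_M\circ Mf$; base change commutes with derivation. An exponential monad is a monad $R$ on $\mathsf{Set}$ together with an $R$-linear isomorphism $\exp_R\colon R'\to R$. A morphism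 of exponential monads $R\to P$ is a monad morphism $f\colon R\to P$ with $f\circ\exp_R=\exp_P\circ f'$ as morphisms $R'\to f^*P$ of left $R$-modules, where $f'_X=f_{X+\{*\}}$. $\Lambda(X)$ is the set of $\lambda$-terms with free variables in $X$ (modulo $\alpha$-conversion, i.e. terms built from variables in $X$, application, and abstraction $\mathsf{abs}\colon\Lambda(X+\{*\})\to\Lambda(X)$ binding $*$) taken modulo the reflexive symmetric transitive closure of $\beta$- and $\eta$-conversion; it is a monad with unit the variable inclusion and multiplication given by substitution, and $\mathsf{abs}\colon\Lambda'\to\Lambda$ is a $\Lambda$-linear isomorphism (with inverse $x\mapsto\mathsf{app}(\hat x,* )$, $\hat x$ the image of $x$ under $\Lambda(\mathrm{inl})$). *)

(* Defs.v *)
From Stdlib Require Import Relation_Operators.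
From mathcomp Require Import all_boot generic_quotient.
From mathcomp Require Import boolp.

Set Implicit Arguments.
Unset Strict Implicit.
Unset Printing Implicit Defensive.

Local Open Scope quotient_scope.

(* A fixed universe playing the role of the category of sets. *)
Definition SET := Type.

Record category := Category {
  ob : Type;
  hom : ob -> ob -> Type;
  idc : forall a, hom a a;
  compc : forall a b c, hom b c -> hom a b -> hom a c;
  compc_idl : forall a b (f : hom a b), compc (idc b) f = f;
  compc_idr : forall a b (f : hom a b), compc f (idc a) = f;
  compc_assoc : forall a b c d (h : hom c d) (g : hom b c) (f : hom a b),
    compc h (compc g f) = compc (compc h g) f }.

Definition is_initial (C : category) (a : ob C) : Prop :=
  forall b : ob C, exists f : hom a b, forall g : hom a b, g = f.

Record functor := Functor {
  fobj :> SET -> SET;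
  fmap : forall X Y : SET, (X -> Y) -> fobj X -> fobj Y;
  fmap_id : forall (X : SET) (a : fobj X), fmap id a = a;
  fmap_comp : forall (X Y Z : SET) (g : Y -> Z) (f : X -> Y) (a : fobj X),
    fmap (g \o f) a = fmap g (fmap f a) }.
Arguments fmap F {X Y} f a : rename.

Lemma eq_fmap (F : functor) (X Y : SET) (f g : X -> Y) (a : F X) :
  f =1 g -> fmap F f a = fmap F g a.
Proof. by move=> /funext ->. Qed.

Record nat_trans (F G : functor) := NatTrans {
  nt :> forall X : SET, F X -> G X;
  naturality : forall (X Y : SET) (f : X -> Y) (a : F X),
    nt (fmap F f a) = fmap G f (nt a) }.
Arguments nt {F G} n {X} a : rename.
Arguments naturality {F G} n {X Y} f a : rename.

Lemma nat_trans_ext (F G : functor) (s t : nat_trans F G) :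
  (forall (X : SET) (a : F X), s X a = t X a) -> s = t.
Proof.
case: s t => [s sP] [t tP] /= st.
have e : s = t by apply: functional_extensionality_dep => X; apply: funext.
by case: _ / e tP => tP; congr NatTrans.
Qed.

Program Definition functor_id : functor :=
  @Functor (fun X => X) (fun X Y f => f) _ _.

Program Definition functor_comp (G F : functor) : functor :=
  @Functor (fun X => G (F X)) (fun X Y f => fmap G (fmap F f)) _ _.
Next Obligation.
have -> : fmap F (@id X) = id by apply: funext => b; exact: fmap_id.
exact: fmap_id.
Qed.
Next Obligation.
have -> : fmap F (g \o f) = fmap F g \o fmap F f.
  by apply: funext => b; exact: fmap_comp.
exact: fmap_comp.
Qed.

Program Definition nat_id (F : functor) : nat_trans F F :=
  @NatTrans F F (fun X a => a) _.

Program Definition nat_comp (F G H : functor)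
    (t : nat_trans G H) (s : nat_trans F G) : nat_trans F H :=
  @NatTrans F H (fun X a => nt t (nt s a)) _.
Next Obligation. by rewrite !naturality. Qed.

Record monad := Monad {
  mon :> functor;
  mu : nat_trans (functor_comp mon mon) mon;
  eta : nat_trans functor_id mon;
  mu_mu : forall (X : SET) (a : mon (mon (mon X))),
    nt mu (fmap mon (@nt _ _ mu X) a) = nt mu (@nt _ _ mu (mon X) a);
  mu_eta : forall (X : SET) (a : mon X), nt mu (@nt _ _ eta (mon X) a) = a;
  mu_fmap_eta : forall (X : SET) (a : mon X),
    nt mu (fmap mon (@nt _ _ eta X) a) = a }.

Record monad_hom (P R : monad) := MonadHom {
  mh :> nat_trans P R;
  mh_mu : forall (X : SET) (a : P (P X)),
    nt mh (nt (mu P) a) = nt (mu R) (nt mh (fmap P (@nt _ _ mh X) a));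
  mh_eta : forall (X : SET) (x : X), nt mh (nt (eta P) x) = nt (eta R) x }.

Lemma monad_hom_ext (P R : monad) (f g : monad_hom P R) :
  (forall (X : SET) (a : P X), f X a = g X a) -> f = g.
Proof.
case: f g => [f f1 f2] [g g1 g2] /= /nat_trans_ext e.
by case: _ / e g1 g2 => g1 g2; congr MonadHom.
Qed.

Program Definition monad_hom_id (R : monad) : monad_hom R R :=
  @MonadHom R R (nat_id R) _ _.
Next Obligation.
by rewrite [fmap _ _ _]fmap_id.
Qed.

Program Definition monad_hom_comp (P Q R : monad)
    (g : monad_hom Q R) (f : monad_hom P Q) : monad_hom P R :=
  @MonadHom P R (nat_comp g f) _ _.
Next Obligation.
rewrite !mh_mu -!naturality -fmap_comp; congr (nt (mu R) (nt g _)).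
Qed.
Next Obligation. by rewrite !mh_eta. Qed.

Record left_module (R : monad) := LeftModule {
  lm :> functor;
  act : nat_trans (functor_comp lm R) lm;
  act_mu : forall (X : SET) (a : lm (R (R X))),
    nt act (fmap lm (@nt _ _ (mu R) X) a) = nt act (@nt _ _ act (R X) a);
  act_eta : forall (X : SET) (a : lm X),
    nt act (fmap lm (@nt _ _ (eta R) X) a) = a }.

Record module_hom (R : monad) (M N : left_module R) := ModuleHom {
  modh :> nat_trans M N;
  modh_linear : forall (X : SET) (a : M (R X)),
    nt (act N) (nt modh a) = nt modh (nt (act M) a) }.

Lemma module_hom_ext (R : monad) (M N : left_module R) (s t : module_hom M N) :
  (forall (X : SET) (a : M X), s X a = t X a) -> s = t.
Proof.
case: s t => [s s1] [t t1] /= /nat_trans_ext e.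
by case: _ / e t1 => t1; congr ModuleHom.
Qed.

Program Definition module_hom_id (R : monad) (M : left_module R) :
  module_hom M M := @ModuleHom R M M (nat_id M) _.

Program Definition module_hom_comp (R : monad) (L M N : left_module R)
    (t : module_hom M N) (s : module_hom L M) : module_hom L N :=
  @ModuleHom R L N (nat_comp t s) _.
Next Obligation. by rewrite !modh_linear. Qed.

Definition is_module_iso (R : monad) (M N : left_module R)
    (t : module_hom M N) : Prop :=
  exists s : module_hom N M,
    module_hom_comp s t = module_hom_id M /\
    module_hom_comp t s = module_hom_id N.

Program Definition self_module (R : monad) : left_module R :=
  @LeftModule R R (mu R) _ _.
Next Obligation. exact: mu_mu. Qed.
Next Obligation. exact: mu_fmap_eta. Qed.

(* X + {*} is encoded as option X, with * = None and inl = Some. *)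
Program Definition deriv_functor (F : functor) : functor :=
  @Functor (fun X => F (option X)) (fun X Y f => fmap F (omap f)) _ _.
Next Obligation.
have -> : omap (@id X) = id by apply: funext => -[].
exact: fmap_id.
Qed.
Next Obligation.
have -> : omap (g \o f) = omap g \o omap f by apply: funext => -[].
exact: fmap_comp.
Qed.

Definition gamma (R : monad) (X : SET) (o : option (R X)) : R (option X) :=
  if o is Some a then fmap R some a else nt (eta R) None.

Lemma gamma_naturality (R : monad) (X Y : SET) (f : X -> Y) (o : option (R X)) :
  fmap R (omap f) (gamma o) = gamma (omap (fmap R f) o).
Proof.
case: o => [a|] /=; first by rewrite -!fmap_comp.
by rewrite -naturality.
Qed.

Lemma gamma_eta (R : monad) (X : SET) (o : option X) :
  gamma (omap (@nt _ _ (eta R) X) o) = nt (eta R) o.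
Proof. by case: o => [x|] //=; rewrite -naturality. Qed.

Lemma gamma_mu (R : monad) (X : SET) (o : option (R (R X))) :
  gamma (omap (@nt _ _ (mu R) X) o) =
  nt (mu R) (fmap R (@gamma R X) (gamma o)).
Proof.
case: o => [a|] /=; last by rewrite -naturality /= mu_eta.
by rewrite -fmap_comp -naturality.
Qed.

Lemma gamma_hom (P R : monad) (f : monad_hom P R) (X : SET)
    (o : option (P X)) :
  nt f (gamma o) = gamma (omap (@nt _ _ f X) o).
Proof. by case: o => [a|] /=; rewrite ?naturality ?mh_eta. Qed.

Program Definition deriv_act (R : monad) (M : left_module R) :
    nat_trans (functor_comp (deriv_functor M) R) (deriv_functor M) :=
  @NatTrans (functor_comp (deriv_functor M) R) (deriv_functor M)
    (fun X a => nt (act M) (fmap M (@gamma R X) a)) _.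
Next Obligation.
rewrite -naturality /= -!fmap_comp; congr (nt (act M) _).
by apply: (@eq_fmap M) => o /=; rewrite gamma_naturality.
Qed.

Program Definition deriv (R : monad) (M : left_module R) : left_module R :=
  @LeftModule R (deriv_functor M) (deriv_act M) _ _.
Next Obligation.
rewrite -!naturality /= -act_mu -!fmap_comp; congr (nt (act M) _).
by apply: (@eq_fmap M) => o /=; rewrite gamma_mu.
Qed.
Next Obligation.
rewrite -fmap_comp -[RHS]act_eta; congr (nt (act M) _).
by apply: (@eq_fmap M) => o /=; rewrite gamma_eta.
Qed.

Program Definition pullback_act (R P : monad) (f : monad_hom R P)
    (M : left_module P) : nat_trans (functor_comp M R) M :=
  @NatTrans (functor_comp M R) M
    (fun X a => nt (act M) (fmap M (@nt _ _ f X) a)) _.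
Next Obligation.
rewrite -naturality /= -!fmap_comp; congr (nt (act M) _).
by apply: (@eq_fmap M) => b /=; rewrite naturality.
Qed.

Program Definition pullback (R P : monad) (f : monad_hom R P)
    (M : left_module P) : left_module R :=
  @LeftModule R M (pullback_act f M) _ _.
Next Obligation.
rewrite -naturality /= -act_mu -!fmap_comp; congr (nt (act M) _).
by apply: (@eq_fmap M) => b /=; rewrite mh_mu naturality.
Qed.
Next Obligation.
rewrite -fmap_comp -[RHS]act_eta; congr (nt (act M) _).
by apply: (@eq_fmap M) => b /=; rewrite mh_eta.
Qed.

Program Definition pullback_hom (R P : monad) (f : monad_hom R P)
    (M N : left_module P) (t : module_hom M N) :
    module_hom (pullback f M) (pullback f N) :=
  @ModuleHom R (pullback f M) (pullback f N) t _.
Next Obligation. by rewrite -naturality modh_linear. Qed.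

Program Definition self_hom (R P : monad) (f : monad_hom R P) :
    module_hom (self_module R) (pullback f (self_module P)) :=
  @ModuleHom R (self_module R) (pullback f (self_module P)) f _.
Next Obligation. by rewrite mh_mu naturality. Qed.

Program Definition deriv_nat (F G : functor) (t : nat_trans F G) :
    nat_trans (deriv_functor F) (deriv_functor G) :=
  @NatTrans (deriv_functor F) (deriv_functor G)
    (fun X a => @nt _ _ t (option X) a) _.
Next Obligation. by rewrite naturality. Qed.

(* f' : R' -> f^*(P'), i.e. derivation of self_hom f followed by the
   identification of (f^*P)' with f^*(P'). *)
Program Definition deriv_self_hom (R P : monad) (f : monad_hom R P) :
    module_hom (deriv (self_module R)) (pullback f (deriv (self_module P))) :=
  @ModuleHom R (deriv (self_module R)) (pullback f (deriv (self_module P)))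
    (deriv_nat f) _.
Next Obligation.
rewrite mh_mu -!naturality -!fmap_comp; congr (nt (mu P) (nt f _)).
by apply: (@eq_fmap R) => o /=; rewrite gamma_hom.
Qed.

Record exp_monad := ExpMonad {
  em :> monad;
  expm : module_hom (deriv (self_module em)) (self_module em);
  expm_iso : is_module_iso expm }.

Record exp_monad_hom (R P : exp_monad) := ExpMonadHom {
  emh :> monad_hom R P;
  emh_exp : module_hom_comp (self_hom emh) (expm R) =
            module_hom_comp (pullback_hom emh (expm P)) (deriv_self_hom emh) }.

Lemma emh_expE (R P : exp_monad) (f : exp_monad_hom R P) (X : SET)
    (a : R (option X)) :
  f X (expm R X a) = expm P X (f (option X) a).
Proof.
exact: (congr1 (fun t : module_hom (deriv (self_module R))
  (pullback f (self_module P)) => nt t a) (emh_exp f)).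
Qed.

Lemma exp_monad_hom_ext (R P : exp_monad) (f g : exp_monad_hom R P) :
  (forall (X : SET) (a : R X), f X a = g X a) -> f = g.
Proof.
case: f g => [f f1] [g g1] /= /monad_hom_ext e.
by case: _ / e g1 => g1; congr ExpMonadHom.
Qed.

Program Definition exp_monad_hom_id (R : exp_monad) : exp_monad_hom R R :=
  @ExpMonadHom R R (monad_hom_id R) _.
Next Obligation. exact: module_hom_ext. Qed.

Program Definition exp_monad_hom_comp (P Q R : exp_monad)
    (g : exp_monad_hom Q R) (f : exp_monad_hom P Q) : exp_monad_hom P R :=
  @ExpMonadHom P R (monad_hom_comp g f) _.
Next Obligation. by apply: module_hom_ext => X a /=; rewrite !emh_expE. Qed.

Program Definition ExpMonadCat : category :=
  @Category exp_monad exp_monad_hom exp_monad_hom_id exp_monad_hom_comp _ _ _.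
Next Obligation. exact: exp_monad_hom_ext. Qed.
Next Obligation. exact: exp_monad_hom_ext. Qed.
Next Obligation. exact: exp_monad_hom_ext. Qed.

(* Lambda-terms up to alpha-conversion, as well-scoped nested terms; the
   variable bound by Abs is None. *)
Inductive term (X : SET) : SET :=
| Var of X
| App of term X & term X
| Abs of term (option X).

Fixpoint tmap (X Y : SET) (f : X -> Y) (t : term X) : term Y :=
  match t with
  | Var x => Var (f x)
  | App t u => App (tmap f t) (tmap f u)
  | Abs t => Abs (tmap (omap f) t)
  end.

Definition lift_subst (X Y : SET) (f : X -> term Y) (o : option X) :
    term (option Y) :=
  if o is Some x then tmap some (f x) else Var None.

Fixpoint subst (X Y : SET) (f : X -> term Y) (t : term X) : term Y :=
  match t with
  | Var x => f x
  | App t u => App (subst f t) (subst f u)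
  | Abs t => Abs (subst (lift_subst f) t)
  end.

Inductive step : forall X : SET, term X -> term X -> Prop :=
| step_beta (X : SET) (t : term (option X)) (u : term X) :
    step (App (Abs t) u) (subst (oapp (@Var X) u) t)
| step_eta (X : SET) (t : term X) :
    step (Abs (App (tmap some t) (Var None))) t
| step_appl (X : SET) (t t' u : term X) :
    step t t' -> step (App t u) (App t' u)
| step_appr (X : SET) (t u u' : term X) :
    step u u' -> step (App t u) (App t u')
| step_abs (X : SET) (t t' : term (option X)) :
    step t t' -> step (Abs t) (Abs t').

Definition conv (X : SET) : term X -> term X -> Prop :=
  clos_refl_sym_trans (term X) (@step X).

Lemma tmap_id (X : SET) (t : term X) : tmap id t = t.
Proof.
elim: t => {X} [X x|X t IHt u IHu|X t IHt] //=; first by rewrite IHt IHu.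
by have -> : omap (@id X) = id; [apply: funext => -[]|rewrite IHt].
Qed.

Lemma subst_tmap (X Y Z : SET) (g : Y -> term Z) (f : X -> Y) (t : term X) :
  subst g (tmap f t) = subst (g \o f) t.
Proof.
elim: t Y Z g f => {X} [X x|X t IHt u IHu|X t IHt] Y Z g f //=.
  by rewrite IHt IHu.
by rewrite IHt; congr (Abs (subst _ _)); apply: funext => -[].
Qed.

Lemma subst_var (X Y : SET) (f : X -> Y) (t : term X) :
  subst (@Var Y \o f) t = tmap f t.
Proof.
elim: t Y f => {X} [X x|X t IHt u IHu|X t IHt] Y f //=.
  by rewrite IHt IHu.
by rewrite -IHt; congr (Abs (subst _ _)); apply: funext => -[].
Qed.

Lemma tmap_comp (X Y Z : SET) (g : Y -> Z) (f : X -> Y) (t : term X) :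
  tmap (g \o f) t = tmap g (tmap f t).
Proof. by rewrite -[RHS]subst_var subst_tmap -subst_var. Qed.

Lemma tmap_subst (X Y Z : SET) (g : Y -> Z) (f : X -> term Y) (t : term X) :
  tmap g (subst f t) = subst (tmap g \o f) t.
Proof.
elim: t Y Z g f => {X} [X x|X t IHt u IHu|X t IHt] Y Z g f //=.
  by rewrite IHt IHu.
rewrite IHt; congr (Abs (subst _ _)); apply: funext => -[x|] //=.
by rewrite -!tmap_comp.
Qed.

Lemma subst_subst (X Y Z : SET) (g : Y -> term Z) (f : X -> term Y)
    (t : term X) :
  subst g (subst f t) = subst (subst g \o f) t.
Proof.
elim: t Y Z g f => {X} [X x|X t IHt u IHu|X t IHt] Y Z g f //=.
  by rewrite IHt IHu.
rewrite IHt; congr (Abs (subst _ _)); apply: funext => -[x|] //=.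
by rewrite tmap_subst subst_tmap.
Qed.

Lemma subst_id (X : SET) (t : term X) : subst (@Var X) t = t.
Proof. by rewrite -[RHS]tmap_id -subst_var. Qed.

Lemma conv_homo (X Y : SET) (F : term X -> term Y) :
  (forall t u, step t u -> conv (F t) (F u)) ->
  forall t u, conv t u -> conv (F t) (F u).
Proof.
move=> FP t u; elim=> {t u} [t u /FP//|t|t u _|t u v _ + _].
- exact: rst_refl.
- exact: rst_sym.
- exact: rst_trans.
Qed.

Lemma conv_app (X : SET) (t t' u u' : term X) :
  conv t t' -> conv u u' -> conv (App t u) (App t' u').
Proof.
move=> tt uu; apply: (@rst_trans _ _ _ (App t' u)).
  apply: (conv_homo (F := fun t => App t u)) tt => ? ? ?.
  exact/rst_step/step_appl.
apply: (conv_homo (F := App t')) uu => ? ? ?.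
exact/rst_step/step_appr.
Qed.

Lemma conv_abs (X : SET) (t t' : term (option X)) :
  conv t t' -> conv (Abs t) (Abs t').
Proof. by apply: conv_homo => ? ? ?; exact/rst_step/step_abs. Qed.

Lemma step_subst (X Y : SET) (f : X -> term Y) (t u : term X) :
  step t u -> step (subst f t) (subst f u).
Proof.
move=> tu; elim: tu Y f => {X t u} /=
  [X t u|X t|X t t' u _ IH|X t u u' _ IH|X t t' _ IH] Y f.
- have := step_beta (subst (lift_subst f) t) (subst f u).
  rewrite !subst_subst.
  congr (step _ (subst _ _)); apply: funext => -[x|] //=.
  by rewrite subst_tmap -[LHS]/(subst (@Var Y) (f x)) subst_id.
- have := step_eta (subst f t).
  by rewrite subst_tmap tmap_subst.
- exact: step_appl.
- exact: step_appr.
- exact: step_abs.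
Qed.

Lemma conv_subst (X Y : SET) (f g : X -> term Y) (t u : term X) :
  (forall x, conv (f x) (g x)) -> conv t u -> conv (subst f t) (subst g u).
Proof.
move=> fg tu; apply: (@rst_trans _ _ _ (subst f u)).
  by apply: conv_homo tu => ? ? ?; exact/rst_step/step_subst.
rewrite -/(conv _ _); elim: u {t tu} Y f g fg => {X} [X x|X t IHt u IHu|X t IHt] Y f g fg /=.
- exact: fg.
- by apply: conv_app; [exact: IHt|exact: IHu].
apply: conv_abs; apply: IHt => -[x|] /=; last exact: rst_refl.
rewrite -!subst_var; apply: conv_homo (fg x) => ? ? ?.
exact/rst_step/step_subst.
Qed.

(* {classic _} supplies the choiceType structure needed by {eq_quot _}. *)
Definition convb (X : SET) : rel {classic term X} := fun t u => `[< conv t u >].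

Lemma convb_refl (X : SET) : reflexive (@convb X).
Proof. by move=> t; apply/asboolP/rst_refl. Qed.

Lemma convb_sym (X : SET) : symmetric (@convb X).
Proof. by move=> t u; apply/asboolP/asboolP; apply: rst_sym. Qed.

Lemma convb_trans (X : SET) : transitive (@convb X).
Proof.
by move=> u t v /asboolP tu /asboolP uv; apply/asboolP/(rst_trans _ _ _ _ _ tu).
Qed.

Canonical conv_equiv (X : SET) : equiv_rel {classic term X} :=
  EquivRel (@convb X) (@convb_refl X) (@convb_sym X) (@convb_trans X).

Definition lam (X : SET) : SET := {eq_quot (conv_equiv X)}.

Definition cls (X : SET) (t : term X) : lam X :=
  \pi_({eq_quot (conv_equiv X)}) (t : {classic term X}).

Definition rep (X : SET) (q : lam X) : term X :=
  repr (q : {eq_quot (conv_equiv X)}).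

Lemma clsP (X : SET) (t u : term X) : cls t = cls u <-> conv t u.
Proof.
split=> [/(@eqmodP _ (conv_equiv X))|tu].
  by move/asboolP.
by apply/(@eqmodP _ (conv_equiv X))/asboolP.
Qed.

Lemma repK (X : SET) (q : lam X) : cls (rep q) = q.
Proof. exact: reprK. Qed.

Lemma cls_rep (X : SET) (t : term X) : conv (rep (cls t)) t.
Proof. by apply/clsP; rewrite repK. Qed.

Definition lam_map (X Y : SET) (f : X -> Y) (q : lam X) : lam Y :=
  cls (tmap f (rep q)).

Definition lam_var (X : SET) (x : X) : lam X := cls (Var x).

(* Independent of the chosen representatives by lam_joinE; in particular the
   class of tmap (@cls X) t is sent to the class of subst id t. *)
Definition lam_join (X : SET) (q : lam (lam X)) : lam X :=
  cls (subst (@rep X) (rep q)).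

Definition lam_app (X : SET) (p q : lam X) : lam X := cls (App (rep p) (rep q)).

Definition lam_abs (X : SET) (q : lam (option X)) : lam X := cls (Abs (rep q)).

Lemma lam_mapE (X Y : SET) (f : X -> Y) (t : term X) :
  lam_map f (cls t) = cls (tmap f t).
Proof.
apply/clsP; rewrite -!subst_var; apply: conv_subst; last exact: cls_rep.
by move=> x; exact: rst_refl.
Qed.

Lemma lam_joinE (X Y : SET) (f : X -> lam Y) (g : X -> term Y) (t : term X) :
  (forall x, f x = cls (g x)) ->
  lam_join (cls (tmap f t)) = cls (subst g t).
Proof.
move=> fg; apply/clsP; apply: (@rst_trans _ _ _ (subst (@rep Y) (tmap f t))).
  by apply: conv_subst; [move=> x; exact: rst_refl|exact: cls_rep].
rewrite subst_tmap; apply: conv_subst; last exact: rst_refl.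
by move=> x /=; rewrite fg; exact: cls_rep.
Qed.

Lemma lam_join_cls (X : SET) (t : term (lam X)) :
  lam_join (cls t) = cls (subst (@rep X) t).
Proof.
by rewrite -[t in LHS]tmap_id; apply: lam_joinE => q; rewrite repK.
Qed.

Lemma lam_appE (X : SET) (t u : term X) :
  lam_app (cls t) (cls u) = cls (App t u).
Proof. by apply/clsP/conv_app; exact: cls_rep. Qed.

Lemma lam_absE (X : SET) (t : term (option X)) :
  lam_abs (cls t) = cls (Abs t).
Proof. by apply/clsP/conv_abs; exact: cls_rep. Qed.

Program Definition lam_functor : functor := @Functor lam lam_map _ _.
Next Obligation. by rewrite /lam_map tmap_id repK. Qed.
Next Obligation. by rewrite -(repK a) !lam_mapE tmap_comp. Qed.

Program Definition lam_eta : nat_trans functor_id lam_functor :=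
  @NatTrans functor_id lam_functor lam_var _.
Next Obligation. by rewrite lam_mapE. Qed.

Program Definition lam_mu :
    nat_trans (functor_comp lam_functor lam_functor) lam_functor :=
  @NatTrans (functor_comp lam_functor lam_functor) lam_functor lam_join _.
Next Obligation.
move: (rep a) (repK a) => t <-.
rewrite lam_mapE (lam_joinE (g := tmap f \o @rep X)) //.
by rewrite lam_join_cls lam_mapE tmap_subst.
Qed.

Program Definition Lambda_monad : monad := @Monad lam_functor lam_mu lam_eta _ _ _.
Next Obligation.
move: (rep a) (repK a) => t <-; rewrite lam_mapE [in RHS]lam_join_cls.
rewrite (lam_joinE (g := subst (@rep X) \o @rep (lam X))) //.
by rewrite lam_join_cls subst_subst.
Qed.
Next Obligation. by rewrite lam_join_cls /= repK. Qed.
Next Obligation.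
move: (rep a) (repK a) => t <-; rewrite lam_mapE (lam_joinE (g := @Var X)) //.
by rewrite subst_id.
Qed.

Program Definition lam_abs_nat :
    nat_trans (deriv_functor lam_functor) lam_functor :=
  @NatTrans (deriv_functor lam_functor) lam_functor lam_abs _.
Next Obligation.
by move: (rep a) (repK a) => t <-; rewrite !(lam_mapE, lam_absE).
Qed.

Program Definition abs_hom :
    module_hom (deriv (self_module Lambda_monad)) (self_module Lambda_monad) :=
  @ModuleHom Lambda_monad (deriv (self_module Lambda_monad))
    (self_module Lambda_monad) lam_abs_nat _.
Next Obligation.
move: (rep a) (repK a) => t <-; rewrite lam_absE lam_join_cls lam_mapE /=.
rewrite (lam_joinE (g := lift_subst (@rep X))) ?lam_absE //.
by case=> [q|] //=.
Qed.

Definition app_star (X : SET) (q : lam X) : lam (option X) :=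
  lam_app (lam_map some q) (lam_var None).

Lemma app_starE (X : SET) (t : term X) :
  app_star (cls t) = cls (App (tmap some t) (Var None)).
Proof. by rewrite /app_star lam_mapE lam_appE. Qed.

Program Definition app_star_nat :
    nat_trans lam_functor (deriv_functor lam_functor) :=
  @NatTrans lam_functor (deriv_functor lam_functor) app_star _.
Next Obligation.
move: (rep a) (repK a) => t <-; rewrite app_starE !lam_mapE app_starE /=.
by rewrite -!tmap_comp.
Qed.

Program Definition app_star_hom :
    module_hom (self_module Lambda_monad) (deriv (self_module Lambda_monad)) :=
  @ModuleHom Lambda_monad (self_module Lambda_monad)
    (deriv (self_module Lambda_monad)) app_star_nat _.
Next Obligation.
move: (rep a) (repK a) => t <-; rewrite app_starE lam_mapE.
rewrite (lam_joinE (g := lift_subst (@rep X))) /=; last by case.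
by rewrite lam_join_cls app_starE subst_tmap tmap_subst.
Qed.

Lemma abs_hom_iso : is_module_iso abs_hom.
Proof.
exists app_star_hom; split; apply: module_hom_ext => X a /=.
  move: (rep a) (repK a) => t <-; rewrite lam_absE app_starE; apply/clsP => /=.
  have := step_beta (tmap (omap some) t) (Var (None : option X)).
  rewrite subst_tmap.
  have -> : oapp (@Var (option X)) (Var None) \o omap some = @Var (option X).
    by apply: funext => -[].
  by rewrite subst_id => ?; exact: rst_step.
move: (rep a) (repK a) => t <-; rewrite app_starE lam_absE; apply/clsP.
exact/rst_step/step_eta.
Qed.

Definition Lambda : exp_monad := ExpMonad abs_hom_iso.

(* Main.v *)
Require Import Defs.
From Stdlib Require Import Relation_Operators.
From mathcomp Require Import all_boot boolp.

(**
The inverse [log] of [exp] makes every exponential monad P a model of the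
lambda-calculus: [a b := log(a){* := b}] interprets application and [exp]
interprets abstraction.  The equations [log o exp = id] and [exp o log = id]
are beta and eta, and linearity of [exp] and [log] is compatibility with
substitution, so the interpretation of terms descends to a morphism
[Lambda -> P].  Conversely, a morphism commutes with [exp], hence with [log]
and with application, so it agrees with the interpretation on every term.
*)

Set Implicit Arguments.
Unset Strict Implicit.
Unset Printing Implicit Defensive.

(** * Kleisli extension of a monad *)

Section MonadBind.
Variable P : monad.

Definition bind (X Y : SET) (f : X -> P Y) (a : P X) : P Y :=
  nt (mu P) (fmap P f a).

Lemma bind_eta (X Y : SET) (f : X -> P Y) (x : X) :
  bind f (nt (eta P) x) = f x.
Proof. by rewrite /bind -naturality mu_eta. Qed.

Lemma eta_bind (X : SET) (a : P X) : bind (@nt _ _ (eta P) X) a = a.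
Proof. exact: mu_fmap_eta. Qed.

Lemma bind_fmap (X Y Z : SET) (g : Y -> P Z) (f : X -> Y) (a : P X) :
  bind g (fmap P f a) = bind (g \o f) a.
Proof. by rewrite /bind fmap_comp. Qed.

Lemma fmap_bind (X Y Z : SET) (g : Y -> Z) (f : X -> P Y) (a : P X) :
  fmap P g (bind f a) = bind (fmap P g \o f) a.
Proof. by rewrite /bind -naturality fmap_comp. Qed.

Lemma bind_eta_comp (X Y : SET) (f : X -> Y) (a : P X) :
  bind (@nt _ _ (eta P) Y \o f) a = fmap P f a.
Proof. by rewrite -bind_fmap eta_bind. Qed.

Lemma bind_bind (X Y Z : SET) (g : Y -> P Z) (f : X -> P Y) (a : P X) :
  bind g (bind f a) = bind (bind g \o f) a.
Proof.
rewrite {1}/bind fmap_bind /bind -mu_mu -fmap_comp.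
by congr (nt (mu P) _).
Qed.

Lemma eq_bind (X Y : SET) (f g : X -> P Y) (a : P X) :
  f =1 g -> bind f a = bind g a.
Proof. by move=> /funext ->. Qed.

End MonadBind.

Lemma mh_bind (P R : monad) (h : monad_hom P R) (X Y : SET) (f : X -> P Y)
    (a : P X) : h Y (bind f a) = bind (h Y \o f) (h X a).
Proof. by rewrite /bind mh_mu -fmap_comp naturality. Qed.

Section ExponentialMonad.
Variable P : exp_monad.

(** The isomorphism hypothesis is a mere existence statement, so the inverse is extracted by choice
    and known only through [expK] and [logK]. *)
Definition logm : module_hom (self_module P) (deriv (self_module P)) :=
  sval (cid (expm_iso P)).

Lemma expK (X : SET) (a : P (option X)) : logm X (expm P X a) = a.
Proof.
rewrite /logm; case: cid => s /= [sK _].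
exact: (congr1 (fun t : module_hom (deriv (self_module P))
  (deriv (self_module P)) => nt t a) sK).
Qed.

Lemma logK (X : SET) (a : P X) : expm P X (logm X a) = a.
Proof.
rewrite /logm; case: cid => s /= [_ sK].
exact: (congr1 (fun t : module_hom (self_module P) (self_module P) =>
  nt t a) sK).
Qed.

Lemma exp_fmap (X Y : SET) (f : X -> Y) (a : P (option X)) :
  fmap P f (expm P X a) = expm P Y (fmap P (omap f) a).
Proof. exact/esym/(naturality (expm P)). Qed.

(** Linearity of [expm] in Kleisli form; [@gamma P Y \o omap f] lifts [f] under the binder, as
    [lift_subst] does for terms. *)
Lemma exp_bind (X Y : SET) (f : X -> P Y) (a : P (option X)) :
  bind f (expm P X a) = expm P Y (bind (@gamma P Y \o omap f) a).
Proof.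
rewrite -bind_fmap /bind exp_fmap.
exact: (modh_linear (expm P)).
Qed.

Lemma log_bind (X Y : SET) (f : X -> P Y) (a : P X) :
  logm Y (bind f a) = bind (@gamma P Y \o omap f) (logm X a).
Proof. by rewrite -[in LHS](logK a) exp_bind expK. Qed.

Definition em_app (X : SET) (a b : P X) : P X :=
  bind (oapp (@nt _ _ (eta P) X) b) (logm X a).

Lemma em_app_bind (X Y : SET) (f : X -> P Y) (a b : P X) :
  bind f (em_app a b) = em_app (bind f a) (bind f b).
Proof.
rewrite /em_app log_bind !bind_bind; apply: eq_bind => -[x|] /=.
  (* On an old variable, the weakening done by [gamma] is cancelled by the substitution for
     [None]. *)
  by rewrite bind_eta bind_fmap eta_bind.
by rewrite bind_eta.
Qed.

Lemma em_app_fmap (X Y : SET) (f : X -> Y) (a b : P X) :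
  fmap P f (em_app a b) = em_app (fmap P f a) (fmap P f b).
Proof. by rewrite -!bind_eta_comp em_app_bind. Qed.

Lemma em_app_beta (X : SET) (a : P (option X)) (b : P X) :
  em_app (expm P X a) b = bind (oapp (@nt _ _ (eta P) X) b) a.
Proof. by rewrite /em_app expK. Qed.

Lemma em_app_eta (X : SET) (a : P X) :
  em_app (fmap P some a) (nt (eta P) None) = logm X a.
Proof.
rewrite /em_app -bind_eta_comp log_bind bind_bind -[RHS]eta_bind.
apply: eq_bind => -[x|] /=; last by rewrite bind_eta.
by rewrite bind_fmap bind_eta.
Qed.

(** * Interpretation of terms and its soundness *)

Fixpoint interp (X : SET) (t : term X) : P X :=
  match t with
  | Var x => nt (eta P) x
  | App t u => em_app (interp t) (interp u)
  | Abs t => expm P _ (interp t)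
  end.

Lemma interp_tmap (X Y : SET) (f : X -> Y) (t : term X) :
  interp (tmap f t) = fmap P f (interp t).
Proof.
elim: t Y f => {X} [X x|X t IHt u IHu|X t IHt] Y f /=.
- exact: (naturality (eta P)).
- by rewrite IHt IHu em_app_fmap.
- by rewrite IHt exp_fmap.
Qed.

Lemma interp_subst (X Y : SET) (f : X -> term Y) (t : term X) :
  interp (subst f t) = bind (@interp Y \o f) (interp t).
Proof.
elim: t Y f => {X} [X x|X t IHt u IHu|X t IHt] Y f /=.
- by rewrite bind_eta.
- by rewrite IHt IHu em_app_bind.
- rewrite IHt exp_bind; congr (expm P _ _).
  by apply: eq_bind => -[x|] //=; rewrite interp_tmap.
Qed.

(** Beta is [em_app_beta] and eta is [em_app_eta] with [logK]; the congruence cases hold because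
    [interp] is compositional. *)
Lemma interp_step (X : SET) (t u : term X) :
  step t u -> interp t = interp u.
Proof.
elim=> {X t u} /= [X t u|X t|X t t' u _ ->|X t u u' _ ->|X t t' _ ->] //.
  by rewrite em_app_beta interp_subst; apply: eq_bind => -[].
by rewrite interp_tmap em_app_eta logK.
Qed.

Lemma interp_conv (X : SET) (t u : term X) :
  conv t u -> interp t = interp u.
Proof.
by elim=> {t u} [t u /interp_step|t|t u _ ->|t u v _ -> _ ->].
Qed.

Definition lam_interp (X : SET) (q : lam X) : P X := interp (rep q).

Lemma lam_interpE (X : SET) (t : term X) : lam_interp (cls t) = interp t.
Proof. exact/interp_conv/cls_rep. Qed.

Program Definition interp_nat : nat_trans Lambda P :=
  @NatTrans Lambda P lam_interp _.
Next Obligation.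
move: (rep a) (repK a) => t <-.
by rewrite lam_mapE !lam_interpE interp_tmap.
Qed.

Program Definition interp_monad_hom : monad_hom Lambda P :=
  @MonadHom Lambda P interp_nat _ _.
Next Obligation.
move: (rep a) (repK a) => t <-.
(* Both sides reduce to one [bind] of [interp P t], as [lam_interp] is [interp] after [rep]. *)
by rewrite lam_join_cls lam_mapE !lam_interpE interp_subst interp_tmap.
Qed.
Next Obligation. exact: lam_interpE. Qed.

Program Definition interp_hom : exp_monad_hom Lambda P :=
  @ExpMonadHom Lambda P interp_monad_hom _.
Next Obligation.
apply: module_hom_ext => X a /=; move: (rep a) (repK a) => t <-.
by rewrite lam_absE !lam_interpE.
Qed.

End ExponentialMonad.

(** * Uniqueness of the morphism *)

Lemma emh_log (R P : exp_monad) (f : exp_monad_hom R P) (X : SET) (a : R X) :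
  f (option X) (logm R X a) = logm P X (f X a).
Proof. by rewrite -[in RHS](logK a) emh_expE expK. Qed.

Lemma emh_app (R P : exp_monad) (f : exp_monad_hom R P) (X : SET)
    (a b : R X) : f X (em_app a b) = em_app (f X a) (f X b).
Proof.
rewrite /em_app mh_bind emh_log.
by apply: eq_bind => -[x|] //=; rewrite mh_eta.
Qed.

(** Identifies the inverse obtained by choice: by eta, [cls t] is the abstraction of the right-hand
    side, and [expK] cancels. *)
Lemma Lambda_log (X : SET) (t : term X) :
  logm Lambda X (cls t) = cls (App (tmap some t) (Var None)).
Proof.
have /clsP <- : conv (Abs (App (tmap some t) (Var None))) t.
  exact/rst_step/step_eta.
by rewrite -lam_absE [LHS](@expK Lambda).
Qed.

Lemma Lambda_app (X : SET) (t u : term X) :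
  @em_app Lambda X (cls t) (cls u) = cls (App t u).
Proof.
rewrite /em_app Lambda_log /bind /= lam_mapE.
rewrite (lam_joinE (g := oapp (@Var X) u)) /=; last by case.
(* The weakened [t] does not contain [None], so only the argument is replaced by [u]. *)
by rewrite subst_tmap subst_id.
Qed.

(** The right-hand side does not depend on [f], which gives uniqueness; [Lambda_app] and [lam_absE]
    express each constructor through operations that [f] preserves. *)
Lemma emh_cls (P : exp_monad) (f : exp_monad_hom Lambda P) (X : SET)
    (t : term X) : f X (cls t) = interp P t.
Proof.
elim: t => {X} [X x|X t IHt u IHu|X t IHt].
- exact: (mh_eta f).
- by rewrite -Lambda_app emh_app IHt IHu.
- by rewrite -lam_absE /= -IHt; exact: (emh_expE f).
Qed.

Theorem theorem3 : is_initial (C := ExpMonadCat) Lambda.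
Proof.
move=> P; exists (interp_hom P) => g; apply: exp_monad_hom_ext => X a.
by rewrite -(repK a) !emh_cls.
Qed.
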